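(* Let $A$ be an $n \times n$ matrix with integer coefficients, and let $\lambda$ be a simple eigenvalue of $A$. Then \[ \kappa_{NSE}(A,\lambda) \le n^{3n}\, 2^{2n} \left(2\sqrt{n}\, H(A)\right)^{2n^3 - 2n}, \] where $H(A) = \max_{i,j}|A_{ij}|$.
   Context: Let $x, y \in \mathbb{C}^n$ be right and left eigenvectors of $A$ for $\lambda$ with $\|x\| = \|y\| = 1$ (Euclidean norm): $Ax = \lambda x$, $y^* A = \lambda y^*$, where $y^*$ is the conjugate transpose. The condition number of the eigenvalue $\lambda$ is $\kappa_{NSE}(A,\lambda) = \sec(\widehat{x,y}) = 1/|y^* x|$. *)

(* Defs.v *)
From HB Require Import structures.
From mathcomp Require Import all_boot all_order all_algebra.
From mathcomp Require Import complex.
From mathcomp Require Import reals.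
Set Implicit Arguments. Unset Strict Implicit. Unset Printing Implicit Defensive.
Import Order.TTheory GRing.Theory Num.Theory.
Local Open Scope ring_scope.

Definition adjv (C : numClosedFieldType) (n : nat) (y : 'cV[C]_n) : 'rV[C]_n :=
  (map_mx Num.conj y)^T.

Definition enorm (C : numClosedFieldType) (n : nat) (x : 'cV[C]_n) : C :=
  sqrtC (\sum_(i < n) `|x i 0| ^+ 2).

Definition cmx (C : numClosedFieldType) (n : nat) (A : 'M[int]_n) : 'M[C]_n :=
  map_mx (fun z : int => z%:~R) A.

Definition simple_eigenvalue (C : numClosedFieldType) (n : nat) (A : 'M[C]_n)
  (lam : C) : Prop := mup lam (char_poly A) = 1%N.

(* kappa_NSE(A, lambda) = 1 / |y^* x| for unit right/left eigenvectors x, y. *)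
Definition kappa_NSE (C : numClosedFieldType) (n : nat) (x y : 'cV[C]_n) : C :=
  `|(adjv y *m x) 0 0|^-1.

Definition height (n : nat) (A : 'M[int]_n) : int :=
  \big[Num.max/0]_(i < n) \big[Num.max/0]_(j < n) `|A i j|.
Arguments cmx {C n} A.

(* Main.v *)
Require Import Defs.
From HB Require Import structures.
From mathcomp Require Import all_boot all_order all_algebra.
From mathcomp Require Import complex.
From mathcomp Require Import reals.
From mathcomp Require Import ring zify.
Set Implicit Arguments. Unset Strict Implicit. Unset Printing Implicit Defensive.
Import Order.TTheory GRing.Theory Num.Theory.
Local Open Scope ring_scope.
Local Open Scope complex_scope.

(* Let [p] be the characteristic polynomial of [A], [q := p / (X - lam)] and
   [K := 2 n h] with [h := max 1 H(A)].  Since [lam] is a simple root, the left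
   kernel of [lam - A] is the line spanned by [y^*], and the rows of [q(A)] lie
   in it by Cayley-Hamilton; applying [q(A)] to [x] gives
   [q(A) = q(lam) / (y^* x) x y^*].  The factors [A - z] of [q(A)] have operator
   norm at most [K], hence [1 / |y^* x| <= n K^(n-1) / |q(lam)|].
   Finally [q(lam) = p'(lam)] is a nonzero eigenvalue of the integer matrix
   [p'(A)], of operator norm at most [n K^n].  The product of the nonzero
   eigenvalues of an integer matrix is a nonzero integer, so
   [|q(lam)| >= (n K^n)^-(n-1)].  Altogether
   [kappa <= n^n K^(n^2-1)], which is below the claimed bound. *)

(** * Left kernels, the adjugate and eigenvectors *)

(** With [w 0 i = 0], row [i] of [N] drops out of [w *m N]. Deleting column [j] as well leaves an
    invertible minor, which kills the other coordinates. *)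
Lemma left_kernel_eq0 (F : fieldType) (n : nat) (N : 'M[F]_n) (i j : 'I_n)
    (w : 'rV[F]_n) :
  cofactor N i j != 0 -> w *m N = 0 -> w 0 i = 0 -> w = 0.
Proof.
rewrite mulf_eq0 signr_eq0 /= => dN0 wN wi.
have wN' : col' i w *m row' i (col' j N) = 0.
  apply/rowP => k; have /rowP/(_ (lift j k)) := wN.
  rewrite !mxE (bigD1_ord i) //= wi mul0r add0r => wNk; rewrite -[RHS]wNk.
  by apply: eq_bigr => l _; rewrite !mxE.
have w'0 : col' i w = 0.
  have Nu : row' i (col' j N) \in unitmx by rewrite unitmxE unitfE.
  by rewrite -[col' i w](mulmxK Nu) wN' mul0mx.
apply/rowP => k; rewrite mxE; case: (unliftP i k) => [l ->|->] //.
by have /rowP/(_ l) := w'0; rewrite !mxE.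
Qed.

(** Kernel vectors are determined by coordinate [i], so [v 0 i] is nonzero and row [k] of [P] is
    [P k i / v 0 i] times [v]. *)
Lemma left_kernel_line (F : fieldType) (n : nat) (N : 'M[F]_n) (i j : 'I_n)
    (m : nat) (v : 'rV[F]_n) (P : 'M[F]_(m, n)) :
  cofactor N i j != 0 -> v != 0 -> v *m N = 0 -> P *m N = 0 ->
  exists d : 'cV[F]_m, P = d *m v.
Proof.
move=> cN v0 vN PN.
have vi : v 0 i != 0.
  by apply: contra v0 => /eqP vi; apply/eqP; apply: left_kernel_eq0 cN vN vi.
exists (\col_k (P k i / v 0 i)); apply/row_matrixP => k; apply/eqP.
rewrite -subr_eq0; apply/eqP/(left_kernel_eq0 cN).
  by rewrite mulmxBl -!row_mul PN -mulmxA vN mulmx0 subrr.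
by rewrite !mxE big_ord1 !mxE divfK // subrr.
Qed.

(** Evaluating at [lam] first would lose [q]. Over the polynomial ring the factor ['X - lam] appears
    on both sides and cancels; evaluation comes last. When [q.[lam]] and [w] are nonzero, this
    yields a nonzero cofactor of [lam - A]. *)
Lemma mul_adj_eigenvector (F : fieldType) (n : nat) (A : 'M[F]_n) (lam : F)
    (q : {poly F}) (w : 'rV[F]_n) :
  char_poly A = ('X - lam%:P) * q -> w *m A = lam *: w ->
  w *m \adj (lam%:M - A) = q.[lam] *: w.
Proof.
move=> pq wA; pose W : 'rV[{poly F}]_n := map_mx polyC w.
have WN : W *m char_poly_mx A = ('X - lam%:P) *: W.
  by rewrite mulmxBr mul_mx_scalar -map_mxM wA map_mxZ /= -scalerBl.
have WadjN : W *m \adj (char_poly_mx A) = q *: W.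
  have nz : 'X - lam%:P != 0 by rewrite polyXsubC_eq0.
  have := congr1 (mulmx W) (mul_mx_adj (char_poly_mx A)).
  rewrite mulmxA WN mul_mx_scalar -/(char_poly A) pq -scalemxAl -scalerA.
  by move/matrixP=> E; apply/matrixP => i j; have:= E i j; rewrite !mxE => /(mulfI nz).
have ev : map_mx (horner_eval lam) W = w.
  by apply/matrixP => i j; rewrite !mxE /horner_eval hornerC.
have := congr1 (map_mx (horner_eval lam)) WadjN.
rewrite map_mxM map_mx_adj map_mxZ /= ev => <-.
congr (_ *m \adj _); apply/matrixP => i j.
by rewrite !mxE /horner_eval !hornerE hornerMn hornerX.
Qed.

Lemma horner_mx_left_eigenvector (F : fieldType) (n : nat) (A : 'M[F]_n.+1)
    (lam : F) (p : {poly F}) (w : 'rV[F]_n.+1) :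
  w *m A = lam *: w -> w *m horner_mx A p = p.[lam] *: w.
Proof.
move=> wA; elim/poly_ind: p => [|p c IH]; first by rewrite rmorph0 mulmx0 horner0 scale0r.
rewrite rmorphD rmorphM /= horner_mx_C horner_mx_X mulmxDr mulmxA IH.
by rewrite -scalemxAl wA mul_mx_scalar scalerA -scalerDl !hornerE.
Qed.

Lemma horner_mx_right_eigenvector (F : fieldType) (n : nat) (A : 'M[F]_n.+1)
    (lam : F) (p : {poly F}) (x : 'cV[F]_n.+1) :
  A *m x = lam *: x -> horner_mx A p *m x = p.[lam] *: x.
Proof.
move=> Ax; elim/poly_ind: p => [|p c IH]; first by rewrite rmorph0 mul0mx horner0 scale0r.
rewrite rmorphD rmorphM /= horner_mx_C horner_mx_X mulmxDl -mulmxA Ax.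
by rewrite -scalemxAr IH mul_scalar_mx scalerA -scalerDl !hornerE mulrC.
Qed.

(** * Operator bounds for the l1 norm on row vectors *)

Section RowNorm.
Variable C : numClosedFieldType.

Definition l1norm (n : nat) (v : 'rV[C]_n) : C := \sum_j `|v 0 j|.

(** An upper bound on the induced operator norm; no supremum has to be formed. *)
Definition opbound (n : nat) (b : C) (M : 'M[C]_n) : Prop :=
  forall v, l1norm (v *m M) <= b * l1norm v.

Lemma l1norm_ge0 n (v : 'rV[C]_n) : 0 <= l1norm v.
Proof. exact: sumr_ge0. Qed.

Lemma l1normD n (v w : 'rV[C]_n) : l1norm (v + w) <= l1norm v + l1norm w.
Proof.
by rewrite -big_split; apply: ler_sum => j _; rewrite mxE ler_normD.
Qed.

Lemma l1normZ n a (v : 'rV[C]_n) : l1norm (a *: v) = `|a| * l1norm v.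
Proof. by rewrite mulr_sumr; apply: eq_bigr => j _; rewrite mxE normrM. Qed.

Lemma l1norm_gt0 n (v : 'rV[C]_n) : v != 0 -> 0 < l1norm v.
Proof.
move=> v0; rewrite lt_def l1norm_ge0 andbT; apply: contra v0.
rewrite psumr_eq0 // => /allP v0; apply/eqP/rowP => j.
by have := v0 j; rewrite mem_index_enum normr_eq0 mxE => /(_ isT)/eqP.
Qed.

Lemma opboundD n b c (M N : 'M[C]_n) :
  opbound b M -> opbound c N -> opbound (b + c) (M + N).
Proof.
move=> hM hN v; rewrite mulmxDr mulrDl.
exact: le_trans (l1normD _ _) (lerD (hM v) (hN v)).
Qed.

Lemma opboundM n b c (M N : 'M[C]_n) :
  0 <= c -> opbound b M -> opbound c N -> opbound (b * c) (M *m N).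
Proof.
move=> c0 hM hN v; rewrite mulmxA; apply: le_trans (hN _) _.
by rewrite (mulrC b) -mulrA ler_wpM2l.
Qed.

Lemma opbound_scalar n a : opbound `|a| (a%:M : 'M[C]_n).
Proof. by move=> v; rewrite mul_mx_scalar l1normZ. Qed.

Lemma opbound_le n b c (M : 'M[C]_n) : b <= c -> opbound b M -> opbound c M.
Proof. by move=> bc hM v; apply: le_trans (hM v) (ler_wpM2r (l1norm_ge0 _) bc). Qed.

Lemma opbound_entries n b (M : 'M[C]_n) :
  (forall i j, `|M i j| <= b) -> opbound (n%:R * b) M.
Proof.
move=> hM v; apply: (@le_trans _ _ (\sum_(j < n) \sum_(i < n) `|v 0 i| * b)).
  apply: ler_sum => j _; rewrite mxE; apply: le_trans (ler_norm_sum _ _ _) _.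
  by apply: ler_sum => i _; rewrite normrM ler_wpM2l.
by rewrite sumr_const card_ord -mulr_suml -/(l1norm v) mulrC mulr_natl -mulrnAl.
Qed.

Lemma root_char_poly_opbound n b (M : 'M[C]_n) z :
  opbound b M -> root (char_poly M) z -> `|z| <= b.
Proof.
rewrite -eigenvalue_root_char => hM /eigenvalueP[v vM v0].
by have := hM v; rewrite vM l1normZ ler_pM2r // l1norm_gt0.
Qed.

Lemma opbound_horner_prod n (K : C) (A : 'M[C]_n.+1) (s : seq C) :
  1 <= K -> (forall z, z \in s -> opbound K (A - z%:M)) ->
  opbound (K ^+ size s) (horner_mx A (\prod_(z <- s) ('X - z%:P))).
Proof.
move=> K1; have K0 : 0 <= K := le_trans ler01 K1.
elim: s => [|z t IH] hs.
  rewrite big_nil expr0 rmorph1 -(@normr1 C); exact: opbound_scalar.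
rewrite big_cons rmorphM /= rmorphB /= horner_mx_X horner_mx_C exprS.
apply: opboundM; first exact: exprn_ge0.
  by apply: hs; rewrite mem_head.
by apply: IH => u ut; apply: hs; rewrite inE ut orbT.
Qed.

Lemma opbound_horner_deriv n (K : C) (A : 'M[C]_n.+1) (s : seq C) :
  1 <= K -> (forall z, z \in s -> opbound K (A - z%:M)) ->
  opbound ((size s)%:R * K ^+ size s)
    (horner_mx A (\prod_(z <- s) ('X - z%:P))^`()).
Proof.
move=> K1; have K0 : 0 <= K := le_trans ler01 K1.
elim: s => [|z t IH] hs.
  rewrite big_nil derivC mul0r => v.
  by rewrite [horner_mx A 0]rmorph0 mulmx0 mul0r /l1norm big1 // => j _; rewrite mxE normr0.
have ht u : u \in t -> opbound K (A - u%:M).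
  by move=> ut; apply: hs; rewrite inE ut orbT.
rewrite big_cons derivM derivXsubC mul1r rmorphD rmorphM /=.
rewrite [horner_mx A ('X - _)]rmorphB /= horner_mx_X horner_mx_C.
have hz : opbound K (A - z%:M) by apply: hs; rewrite mem_head.
apply: opbound_le (opboundD (opbound_horner_prod K1 ht)
  (opboundM _ hz (IH ht))).
  (* The product rule adds one term [K ^+ size t], raised to the next power of [K] because [K] is at
     least 1. *)
  by rewrite -natr1 mulrDl mul1r addrC exprS mulrCA lerD2l ler_peMl // exprn_ge0.
by rewrite mulr_ge0 ?exprn_ge0 ?ler0n.
Qed.

End RowNorm.

(** * Nonzero roots of monic integer polynomials *)

Lemma prod_XsubC_lowest_coef (F : idomainType) (s : seq F) :
  exists k, (\prod_(z <- s) ('X - z%:P))`_k = \prod_(z <- s | z != 0) - z.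
Proof.
(* The zero roots contribute a power of ['X]; the coefficient just above it is the constant term of
   the remaining product. *)
exists (count_mem 0 s); rewrite (bigID (pred1 0)) /=.
rewrite (eq_bigr (fun=> 'X)) => [|z /eqP->]; last by rewrite subr0.
rewrite big_const_seq iter_mulr_1 coefXnM ltnn subnn -horner_coef0.
by rewrite horner_prod; apply: eq_bigr => z _; rewrite !hornerE.
Qed.

(** Up to sign, the product of the nonzero roots is a coefficient of [P], hence a nonzero integer of
    modulus at least 1. The roots other than [mu] contribute at most [b] each. *)
Lemma nonzero_root_lower_bound (C : numClosedFieldType) (P : {poly int})
    (s : seq C) (b mu : C) :
  map_poly intr P = \prod_(z <- s) ('X - z%:P) ->
  1 <= b -> (forall z, z \in s -> `|z| <= b) -> mu \in s -> mu != 0 ->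
  1 <= `|mu| * b ^+ (size s).-1.
Proof.
move=> Ps b1 hs mus mu0.
have [k] := prod_XsubC_lowest_coef s; rewrite -Ps coef_map /= => Pk.
have prod1 : 1 <= `|\prod_(z <- s | z != 0) - z|.
  rewrite -Pk -intr_norm ler1z -gtz0_ge1 normr_gt0 -(@intr_eq0 C) Pk.
  rewrite prodf_seq_neq0.
  by apply/allP => z _; apply/implyP; rewrite oppr_eq0.
apply: le_trans prod1 _; rewrite (perm_big _ (perm_to_rem mus)) big_cons mu0.
rewrite normrM normrN ler_wpM2l // normr_prod -(size_rem mus).
have : {subset rem mu s <= s} by exact: mem_rem.
elim: (rem mu s) => [|z t IH] ht; first by rewrite big_nil.
have b0 : 0 <= b := le_trans ler01 b1.
have IHt : \prod_(i <- t | i != 0) `|- i| <= b ^+ size t.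
  by apply: IH => u ut; apply: ht; rewrite inE ut orbT.
rewrite big_cons /= exprS; case: ifP => _.
  by rewrite ler_pM ?prodr_ge0 // normrN hs // ht ?mem_head.
(* A zero root is absent from the product but still counted in the exponent, which is harmless as
   [b] is at least 1. *)
by apply: le_trans IHt _; rewrite ler_peMl // exprn_ge0.
Qed.

Lemma monic_split (C : closedFieldType) (p : {poly C}) :
  p \is monic -> exists s : seq C, p = \prod_(z <- s) ('X - z%:P).
Proof.
move/monicP => p1; have [s sP] := closed_field_poly_normal p.
by exists s; rewrite sP p1 scale1r.
Qed.

(** * Euclidean unit vectors in the l1 norm *)

Lemma sum_norm_adjv (C : numClosedFieldType) (n : nat) (x : 'cV[C]_n) :
  l1norm (adjv x) = \sum_i `|x i 0|.
Proof. by apply: eq_bigr => i _; rewrite !mxE norm_conjC. Qed.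

Section UnitVector.
Variables (C : numClosedFieldType) (n : nat) (x : 'cV[C]_n).
Hypothesis x1 : enorm x = 1.

Lemma enorm1_sum : \sum_i `|x i 0| ^+ 2 = 1.
Proof. by rewrite -[LHS]sqrtCK -/(enorm x) x1 expr1n. Qed.

Lemma enorm1_entry i : `|x i 0| <= 1.
Proof.
rewrite -(@expr_le1 _ 2) // -enorm1_sum (bigD1 i) //= lerDl.
by apply: sumr_ge0 => j _; apply: exprn_ge0.
Qed.

Lemma adjv_mul_self : adjv x *m x = 1%:M.
Proof.
apply/matrixP => i j; rewrite !ord1 !mxE -enorm1_sum.
by apply: eq_bigr => k _; rewrite !mxE mulrC -normCK.
Qed.

(** Each entry has modulus at most 1, so its modulus dominates its square. *)
Lemma l1norm_adjv_ge1 : 1 <= l1norm (adjv x).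
Proof.
rewrite sum_norm_adjv -enorm1_sum; apply: ler_sum => i _.
by rewrite expr2 ler_piMr // enorm1_entry.
Qed.

Lemma l1norm_adjv_le : l1norm (adjv x) <= n%:R.
Proof.
rewrite sum_norm_adjv -[n in n%:R]card_ord -sumr_const.
by apply: ler_sum => i _; apply: enorm1_entry.
Qed.

Lemma adjv_neq0 : adjv x != 0.
Proof.
by apply/eqP => x0; have := l1norm_adjv_ge1; rewrite x0 /l1norm big1 ?ler10 // => j _;
  rewrite mxE normr0.
Qed.
End UnitVector.

(** * The two estimates for q(lam) and their combination *)

Lemma deriv_char_poly_lower_bound (C : numClosedFieldType) (n : nat)
    (A : 'M[int]_n.+1) (K lam : C) (v : 'rV[C]_n.+1) (s : seq C) :
  1 <= K -> char_poly (cmx A) = \prod_(z <- s) ('X - z%:P) ->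
  (forall z, z \in s -> opbound K (cmx A - z%:M)) ->
  v *m cmx A = lam *: v -> v != 0 -> (char_poly (cmx A))^`().[lam] != 0 ->
  1 <= `|(char_poly (cmx A))^`().[lam]| * (n.+1%:R * K ^+ n.+1) ^+ n.
Proof.
move=> K1 ps hs vA v0 mu0; set mu := _.[lam] in mu0 *.
have ss : size s = n.+1.
  by have := size_char_poly (@cmx C _ A); rewrite ps size_prod_XsubC => -[].
(* Forming [M] over the integers gives it an integer characteristic polynomial. *)
pose M := horner_mx A (char_poly A)^`().
have MC : map_mx intr M = horner_mx (cmx A) (char_poly (cmx A))^`() :> 'M[C]_n.+1.
  by rewrite map_horner_mx -deriv_map map_char_poly.
have [s' ps'] := monic_split (char_poly_monic (map_mx intr M : 'M[C]_n.+1)).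
have ss' : (size s').-1 = n.
  by have := size_char_poly (map_mx intr M : 'M[C]_n.+1); rewrite ps' size_prod_XsubC => -[->].
have Mb : opbound (n.+1%:R * K ^+ n.+1) (map_mx intr M : 'M[C]_n.+1).
  by rewrite MC ps; have := opbound_horner_deriv K1 hs; rewrite ss.
rewrite -[X in _ ^+ X]ss'; apply: (@nonzero_root_lower_bound _ (char_poly M)) => //.
- by rewrite map_char_poly.
- by rewrite mulr_ege1 ?exprn_ege1 // ler1n.
- move=> z zs'; apply: root_char_poly_opbound Mb _.
  by rewrite ps' root_prod_XsubC.
rewrite -root_prod_XsubC -ps' -eigenvalue_root_char; apply/eigenvalueP.
by exists v => //; rewrite MC (horner_mx_left_eigenvector _ vA).
Qed.

(** In the exponent of [K], [n] comes from the bound on q(A) and [n.+1 * n] from the lower bound on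
    q(lam). One factor [n.+1] comes from the l1 norm of the adjoint of [x], the other [n] from the
    derivative. *)
Lemma kappa_NSE_bound (C : numClosedFieldType) (n : nat) (A : 'M[int]_n.+1)
    (h lam : C) (x y : 'cV[C]_n.+1) :
  1 <= h -> (forall i j, `|cmx A i j| <= h) ->
  simple_eigenvalue (cmx A) lam ->
  cmx A *m x = lam *: x -> adjv y *m cmx A = lam *: adjv y ->
  enorm x = 1 -> enorm y = 1 ->
  (adjv y *m x) 0 0 != 0 /\
  kappa_NSE x y <=
    n.+1%:R ^+ n.+1 * (2 * n.+1%:R * h) ^+ (n + n.+1 * n).
Proof.
move=> h1 hA lam1 Ax yA x1 y1; pose AC : 'M[C]_n.+1 := cmx A.
set K := 2 * _ * h.
have K1 : 1 <= K by rewrite !mulr_ege1 ?ler1n.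
have Ab : opbound (n.+1%:R * h) AC by apply: opbound_entries.
have [s ps] := monic_split (char_poly_monic AC).
have hs z : z \in s -> opbound K (AC - z%:M).
  (* The eigenvalue [z] is itself bounded by [n.+1 * h], whence the 2 in [K]. *)
  move=> zs; have -> : AC - z%:M = AC + (- z)%:M by rewrite raddfN.
  apply: opbound_le (opboundD Ab (opbound_scalar (- z))).
  rewrite normrN /K -mulrA [2 * (_ * _)]mulr_natl mulr2n lerD2l.
  by apply: root_char_poly_opbound Ab _; rewrite ps root_prod_XsubC.
have slam : count_mem lam s = 1%N by rewrite -mu_prod_XsubC -ps.
have lams : lam \in s by rewrite -has_pred1 has_count slam.
pose t := rem lam s; pose q := \prod_(z <- t) ('X - z%:P).
have st : size t = n.
  have := size_char_poly AC; rewrite ps size_prod_XsubC => -[ss].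
  by rewrite size_rem // ss.
have pq : char_poly AC = ('X - lam%:P) * q.
  by rewrite ps (perm_big _ (perm_to_rem lams)) big_cons.
have qlam : (char_poly AC)^`().[lam] = q.[lam].
  by rewrite pq derivM derivXsubC !hornerE subrr mul0r addr0.
have q0 : q.[lam] != 0.
  rewrite -/(root q lam) root_prod_XsubC -has_pred1 has_count count_rem.
  by rewrite slam lams /= eqxx.
have y0 := adjv_neq0 y1.
have : \adj (lam%:M - AC) != 0.
  apply: contra_neq q0 => adj0; have := mul_adj_eigenvector pq yA.
  by rewrite adj0 mulmx0 => /esym/eqP; rewrite scaler_eq0 (negPf y0) orbF => /eqP.
case/matrix0Pn => j; case=> i; rewrite mxE => cij.
have [d Pd] : exists d : 'cV[C]_n.+1, horner_mx AC q = d *m adjv y.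
  apply: left_kernel_line cij y0 _ _.
    by rewrite mulmxBr mul_mx_scalar yA subrr.
  apply/eqP; rewrite -oppr_eq0 -mulmxN opprB; apply/eqP.
  have -> : AC - lam%:M = horner_mx AC ('X - lam%:P).
    by rewrite rmorphB /= horner_mx_X horner_mx_C.
  by rewrite mulmxE -rmorphM [q * _]mulrC -pq; apply: Cayley_Hamilton.
set c := (adjv y *m x) 0 0.
have cx : q.[lam] *: x = c *: d.
  rewrite -(horner_mx_right_eigenvector q Ax) Pd -mulmxA.
  by rewrite [adjv y *m x]mx11_scalar mul_mx_scalar.
(* If [c] vanished, [cx] would force [x] to be zero. *)
have c0 : c != 0.
  apply: contraNneq y0 => c0; move: cx; rewrite c0 scale0r => /eqP.
  rewrite scaler_eq0 (negPf q0) /= => /eqP x0; have := adjv_mul_self x1.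
  by rewrite x0 mulmx0 => /matrixP/(_ 0 0)/eqP; rewrite !mxE eq_sym oner_eq0.
split=> //; rewrite /kappa_NSE -/c.
have Pb : opbound (K ^+ n) (horner_mx AC q).
  rewrite -[X in _ ^+ X]st; apply: opbound_horner_prod => // z zt.
  by apply: hs; apply: mem_rem zt.
have cq : `|q.[lam]| <= `|c| * (n.+1%:R * K ^+ n).
  (* The test row is the adjoint of [x]: q(A) sends it to [c^-1 * q.[lam]] times [adjv y], because
     [x] is a unit vector. *)
  have := Pb (adjv x); rewrite Pd.
  have -> : d = (c^-1 * q.[lam]) *: x by rewrite -scalerA cx scalerK.
  rewrite -scalemxAl -scalemxAr mulmxA (adjv_mul_self x1) mul1mx l1normZ.
  rewrite normrM normfV => xb.
  rewrite -ler_pdivrMl ?normr_gt0 // (mulrC n.+1%:R).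
  apply: le_trans (le_trans xb _).
    by rewrite ler_peMr ?mulr_ge0 ?invr_ge0 // l1norm_adjv_ge1.
  by rewrite ler_wpM2l ?exprn_ge0 ?(le_trans ler01) // l1norm_adjv_le.
have q1 := deriv_char_poly_lower_bound K1 ps hs yA y0.
rewrite -/AC qlam in q1; have {}q1 := q1 q0.
rewrite -[X in X <= _]mul1r ler_pdivrMr ?normr_gt0 //.
apply: le_trans q1 _; apply: le_trans (ler_wpM2r _ cq) _.
  by rewrite !exprn_ge0 ?mulr_ge0 ?exprn_ge0 ?ler0n ?(le_trans ler01).
rewrite [(_ * K ^+ n.+1) ^+ n]exprMn -exprM [K ^+ (_ + _)]exprD [_ ^+ n.+1]exprS.
by rewrite -[leLHS]mulrA mulrACA mulrC.
Qed.

(** * Height and comparison with the stated bound *)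

Lemma entry_le_height (n : nat) (A : 'M[int]_n) i j : `|A i j| <= height A.
Proof.
apply: le_trans (le_bigmax 0 (fun k => \big[Num.max/0]_(l < n) `|A k l|) i).
exact: (le_bigmax 0 (fun l => `|A i l|) j).
Qed.

(** The zero matrix has characteristic polynomial a pure power of ['X], and in dimension at least 2
    its only root is not simple. *)
Lemma height_gt0 (C : numClosedFieldType) (n : nat) (A : 'M[int]_n.+2) (lam : C) :
  simple_eigenvalue (cmx A) lam -> 0 < height A.
Proof.
move=> lam1; rewrite ltNge; apply/negP => h0; move: lam1.
have -> : @cmx C _ A = 0.
  apply/matrixP => i j; rewrite !mxE; apply/eqP; rewrite intr_eq0 -normr_le0.
  exact: le_trans (entry_le_height _ _ _) h0.
rewrite /simple_eigenvalue char_poly_trig ?mx0_is_trig //.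
under eq_bigr do rewrite mxE.
by rewrite prodr_const card_ord mup_XsubCX; case: ifP.
Qed.

Theorem theorem3 (R : realType) (n : nat) (A : 'M[int]_n) (lam : R[i])
  (x y : 'cV[R[i]]_n) :
  simple_eigenvalue (cmx A) lam ->
  cmx A *m x = lam *: x ->
  adjv y *m cmx A = lam *: adjv y ->
  enorm x = 1 -> enorm y = 1 ->
  (adjv y *m x) 0 0 != 0 /\
  kappa_NSE x y <=
    (n ^ (3 * n))%:R * 2 ^+ (2 * n) *
    (2 * sqrtC n%:R * (height A)%:~R) ^+ (2 * n ^ 3 - 2 * n).
Proof.
case: n A x y => [|n] A x y lam1 Ax yA x1 y1.
  (* In dimension 0 there is no unit vector. *)
  by move: x1; rewrite /enorm big_ord0 sqrtC0 => /eqP; rewrite eq_sym oner_eq0.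
pose h : int := Num.max 1 (height A).
have h1 : 1 <= h%:~R :> R[i] by rewrite ler1z le_max lexx.
have hA i j : `|cmx A i j| <= h%:~R :> R[i].
  by rewrite mxE -intr_norm ler_int le_max entry_le_height orbT.
have [c0 kb] := kappa_NSE_bound h1 hA lam1 Ax yA x1 y1.
split=> //; apply: le_trans kb _.
have H0 : 0 <= (height A)%:~R :> R[i].
  by rewrite ler0z (le_trans _ (entry_le_height A 0 0)).
have nn0 : 0 <= n.+1%:R ^+ n.+1 :> R[i] by rewrite exprn_ge0 ?ler0n.
apply: ler_pM => //.
- by rewrite exprn_ge0 // !mulr_ge0 ?ler0n // (le_trans ler01 h1).
- apply: (@le_trans _ _ ((n.+1 ^ (3 * n.+1))%:R)).
    by rewrite -natrX ler_nat leq_pexp2l // leq_pmull.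
  by rewrite ler_peMr ?ler0n // exprn_ege1 // ler1n.
case: n A x y lam1 Ax yA x1 y1 @h h1 hA c0 H0 nn0 => [|n] A x y lam1 Ax yA x1 y1 h h1 hA c0 H0 nn0.
  (* In dimension 1 the height may be 0, but both exponents are 0. *)
  by rewrite !expr0.
have H1 : 1 <= height A by rewrite -gtz0_ge1 (height_gt0 lam1).
have -> : h = height A by apply/max_idPr.
set N := n.+2; set H : R[i] := (height A)%:~R.
have H1' : 1 <= H by rewrite ler1z.
pose S := 2 * sqrtC N%:R * H.
have SE : S ^+ 2 = (2 * N%:R * H) * (2 * H).
  by rewrite !exprMn sqrtCK !expr2; ring.
have sN1 : 1 <= sqrtC N%:R :> R[i].
  by rewrite -[leLHS]sqrtC1 ler_sqrtC ?ler1n // qualifE /= ?ler0n ?ler01.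
have S1 : 1 <= S by rewrite !mulr_ege1 ?ler1n.
have K0 : 0 <= 2 * N%:R * H by rewrite !mulr_ge0 ?ler0n.
have KS : 2 * N%:R * H <= S ^+ 2 by rewrite SE ler_peMr ?mulr_ege1 ?ler1n.
apply: (@le_trans _ _ ((S ^+ 2) ^+ (n.+1 + N * n.+1))).
  by rewrite lerXn2r // qualifE /= (le_trans K0 KS).
(* With [N = n.+2] the exponents compare as 2(N^2 - 1) and 2N(N^2 - 1). *)
rewrite -exprM ler_weXn2l // /N; nia.
Qed.
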